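(* For $i=1,2,3$ let $G_i$ be an $r_i$-regular graph with $n_i\ge1$ vertices and $m_i$ edges, with $r_1\ge1$. Let $\theta_i$ ($1\le i\le n_1$), $\mu_j$ ($1\le j\le n_2$), $\eta_k$ ($1\le k\le n_3$) be the eigenvalues of $\mathcal L(G_1)$, $\mathcal L(G_2)$, $\mathcal L(G_3)$, respectively, each listed in non-increasing order with multiplicity (so $\theta_{n_1}=\mu_{n_2}=\eta_{n_3}=0$). Then the normalized Laplacian spectrum (multiset of eigenvalues of $\mathcal L(\mathcal G)$) of $\mathcal G=G_1^S\bowtie(G_2^V\cup G_3^E)$ consists of: (a) $\frac{r_1+r_2\mu_j}{r_1+r_2}$, repeated $n_1$ times, for each $j=1,2,\dots,n_2-1$; (b) $\frac{1+r_3\eta_k}{r_3+1}$, repeated $m_1$ times, for each $k=1,2,\dots,n_3-1$; (c) the two roots of the equation $$(2n_2r_3+n_3r_3+2r_3+2n_2+n_3+2)\lambda^2-(2n_2r_3+n_3r_3+2r_3+4n_2+2n_3+4)\lambda+2n_2+2=0,$$ each root repeated $m_1-n_1$ times; (d) for each $i=1,2,\dots,n_1$, the four roots of the equation $$(2n_2+n_3+2)((1+r_3)\lambda-1)((r_1+r_2)\lambda-r_1)(\lambda-1)^2-n_3(\lambda-1)((r_1+r_2)\lambda-r_1)$$ $$-(2-\theta_i)\big((r_1+r_2+n_2r_1)\lambda-(r_1+r_1n_2)\big)((1+r_3)\lambda-1)=0.$$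
   Context: All graphs are finite, simple and undirected. The normalized Laplacian matrix of $G$ is $\mathcal L(G)=I-D(G)^{-1/2}A(G)D(G)^{-1/2}$, where $A(G)$ is the adjacency matrix and $D(G)$ the diagonal degree matrix; rows and columns of $\mathcal L(G)$ indexed by isolated vertices are taken to be zero (e.g. $\mathcal L(K_1)=(0)$). If $m_1<n_1$ (which happens only for $r_1=1$), ''repeated $m_1-n_1$ times'' is read formally as a negative multiplicity: the corresponding values are removed $n_1-m_1$ times from the multiset given by the other items. The subdivision graph $S(G_1)$ is obtained by inserting a new vertex into every edge of $G_1$; its vertex set is $V(G_1)\cup I(G_1)$, where $I(G_1)$ is the set of inserted vertices, in bijection with the edges of $G_1$. The graph $G_1^S\bowtie(G_2^V\cup G_3^E)$ (subdivision vertex-edge neighbourhood vertex-corona) consists of $S(G_1)$, $|V(G_1)|$ copies of $G_2$ and $|I(G_1)|$ copies of $G_3$, all vertex-disjoint, where for each $i$ every neighbour in $S(G_1)$ of the $i$-th vertex of $V(G_1)$ is joined to every vertex of the $i$-th copy of $G_2$, and for each $i$ the $i$-th vertex of $I(G_1)$ is joined to every vertex of the $i$-th copy of $G_3$. *)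

(* Defs.v *)
From mathcomp Require Import all_boot all_order all_algebra.

Set Implicit Arguments.
Unset Strict Implicit.
Unset Printing Implicit Defensive.

Import Order.TTheory GRing.Theory Num.Theory.
Local Open Scope ring_scope.

Record sgraph := SGraph {
  vert :> finType;
  adj : rel vert;
  adj_sym : symmetric adj;
  adj_irr : irreflexive adj }.

Definition degree (G : sgraph) (v : G) : nat := #|[set w : G | adj v w]|.

Definition regular (r : nat) (G : sgraph) : Prop :=
  forall v : G, degree v = r.

Definition edges (G : sgraph) : {set {set G}} :=
  [set [set p.1; p.2] | p : G * G & adj p.1 p.2].

(* The inserted vertices of the subdivision graph are the edges themselves. *)
Definition edge_type (G : sgraph) : finType := {e : {set G} | e \in edges G}.

Section Subdivision.
Variable G : sgraph.

Definition sub_adj (x y : G + edge_type G) : bool :=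
  match x, y with
  | inl v, inr e => v \in val e
  | inr e, inl v => v \in val e
  | _, _ => false
  end.

Lemma sub_adj_sym : symmetric sub_adj.
Proof. by case=> [v|e] [w|f]. Qed.

Lemma sub_adj_irr : irreflexive sub_adj.
Proof. by case. Qed.

Definition subdivision : sgraph := SGraph sub_adj_sym sub_adj_irr.

End Subdivision.

Section Corona.
Variables G1 G2 G3 : sgraph.

(* The vertex (v, u) of G1 * G2 is the vertex u in the copy of G2 attached    *)
(* to the vertex v of G1; (e, w) is the vertex w in the copy of G3 attached   *)
(* to the inserted vertex e.                                                  *)
Definition corona_vert : finType :=
  (subdivision G1 + G1 * G2 + edge_type G1 * G3)%type.

Definition corona_adj (x y : corona_vert) : bool :=
  match x, y with
  | inl (inl s), inl (inl t) => adj s t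
  | inl (inr (v, u)), inl (inr (v', u')) => (v == v') && adj u u'
  | inr (e, w), inr (e', w') => (e == e') && adj w w'
  | inl (inl s), inl (inr (v, _)) => adj s (inl v : subdivision G1)
  | inl (inr (v, _)), inl (inl s) => adj s (inl v : subdivision G1)
  | inl (inl s), inr (e, _) => s == inr e
  | inr (e, _), inl (inl s) => s == inr e
  | _, _ => false
  end.

Lemma corona_adj_sym : symmetric corona_adj.
Proof.
case=> [[s|[v u]]|[e w]] [[t|[v' u']]|[e' w']] //=.
- exact: (@adj_sym (subdivision G1)).
- by rewrite eq_sym adj_sym.
- by rewrite eq_sym adj_sym.
Qed.

Lemma corona_adj_irr : irreflexive corona_adj.
Proof.
case=> [[s|[v u]]|[e w]] /=.
- exact: (@adj_irr (subdivision G1)).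
- by rewrite adj_irr andbF.
- by rewrite adj_irr andbF.
Qed.

Definition corona : sgraph := SGraph corona_adj_sym corona_adj_irr.

End Corona.

Section Laplacian.
Variables (R : rcfType) (G : sgraph).

Definition adjacency_mx : 'M[R]_#|G| :=
  \matrix_(i, j) (adj (enum_val i) (enum_val j))%:R.

Definition inv_sqrt_degree_mx : 'M[R]_#|G| :=
  diag_mx (\row_i (Num.sqrt (degree (enum_val i))%:R)^-1).

Definition isolated (v : G) : bool := degree v == 0%N.

Definition normalized_laplacian : 'M[R]_#|G| :=
  \matrix_(i, j)
    if isolated (enum_val i) || isolated (enum_val j) then 0
    else (1%:M - inv_sqrt_degree_mx *m adjacency_mx *m inv_sqrt_degree_mx) i j.

End Laplacian.

(* s lists all the roots of p with multiplicity: p is nonzero and splits over *)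
(* R with exactly these roots, so s is unique up to permutation.              *)
Definition roots_of (R : rcfType) (p : {poly R}) (s : seq R) : Prop :=
  p != 0 /\ p = lead_coef p *: \prod_(x <- s) ('X - x%:P).

Definition is_spectrum (R : rcfType) (n : nat) (A : 'M[R]_n) (s : seq R) :=
  roots_of (char_poly A) s.

Definition corona_quadratic (R : rcfType) (n2 n3 r3 : nat) : {poly R} :=
  (2 * n2 * r3 + n3 * r3 + 2 * r3 + 2 * n2 + n3 + 2)%:R *: 'X^2
  - (2 * n2 * r3 + n3 * r3 + 2 * r3 + 4 * n2 + 2 * n3 + 4)%:R *: 'X
  + (2 * n2 + 2)%:R%:P.

Definition corona_quartic (R : rcfType) (n2 n3 r1 r2 r3 : nat) (theta : R) :
    {poly R} :=
  (2 * n2 + n3 + 2)%:R *: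
    (((1 + r3)%:R *: 'X - 1) * ((r1 + r2)%:R *: 'X - r1%:R%:P) * ('X - 1) ^+ 2)
  - n3%:R *: (('X - 1) * ((r1 + r2)%:R *: 'X - r1%:R%:P))
  - (2 - theta) *:
    (((r1 + r2 + n2 * r1)%:R *: 'X - (r1 + r1 * n2)%:R%:P)
     * ((1 + r3)%:R *: 'X - 1)).

(* Main.v *)
Require Import Defs.
From mathcomp Require Import all_boot all_order all_algebra.
From mathcomp Require Import all_fingroup complex ring zify.
Import Order.TTheory GRing.Theory Num.Theory.
Local Open Scope ring_scope.

Set Implicit Arguments.
Unset Strict Implicit.
Unset Printing Implicit Defensive.

(** Write [G] for the corona, [D] and [A] for its degree and adjacency matrices
and [y = x - 1].  No vertex of [G] is isolated, so [x - L(G)] equals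
[D^(-1/2) (y D + A) D^(-1/2)], and up to the nonzero constant [det D] the
characteristic polynomial of [L(G)] at [x] is [det (y D + A)].

This determinant is computed by Schur complements.  The copies of [G2] and of
[G3] hang off the subdivision graph; in a copy, the block of [y D + A] has
constant row sums because the graph is regular, so the all-one vector is an
eigenvector and its inverse is only ever needed on that vector
([fin_det_pendant]).  Removing the copies leaves powers of the determinants of
these blocks, which are known from the spectra of [L(G2)] and [L(G3)], and a
perturbed matrix on the subdivision graph.  There, with [B] the vertex-edge
incidence matrix, removing the original vertices leaves [a I - c B^T B] on the
edges; by Sylvester's identity this is [a I - c B B^T] on the vertices up to a
power of [a], and [B B^T = r1 I + A(G1) = r1 (2 I - L(G1))]
([fin_det_incidence]).  The roots of the numerator of [a] are those of the
quadratic, and each eigenvalue [theta] of [L(G1)] contributes one quartic.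

The factors at the last eigenvalues of [L(G2)] and [L(G3)], which are 0 because
0 is an eigenvalue and none is negative ([regular_last_eigenvalue]), cancel the
denominators of [a] and of the row-sum inverses.  Multiplying by [Q ^+ n1], with [Q] the
quadratic, avoids the exponent [m1 - n1] and its sign: one obtains the identity
of polynomials [corona_char_poly], first outside finitely many points.

It remains to see that everything splits over the real closed field.  The
quadratic has a nonnegative discriminant; [L(G)] is symmetric, hence its
characteristic polynomial splits, by the spectral theorem over the complex
closure ([symmetric_spectrum]); and each quartic divides the product of the
characteristic polynomial with a power of [Q], hence splits as well.  Unique
factorization into monic linear factors then identifies the multisets of
roots. *)

(** * Determinants of matrices indexed by finite types *)

Section DetT.
Variable R : comNzRingType.
Implicit Types T : finType.

(** The vertices of the graphs live in sums and products of finite types, so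
matrices are handled as functions on the index type; the enumeration used to
turn them into genuine matrices is irrelevant for the determinant. *)
Definition fin_mx T (f : T -> T -> R) : 'M[R]_#|T| :=
  \matrix_(i, j) f (enum_val i) (enum_val j).

Definition fin_det T (f : T -> T -> R) : R := \det (fin_mx f).

Lemma eq_fin_det T (f g : T -> T -> R) : f =2 g -> fin_det f = fin_det g.
Proof. by move=> fg; congr (\det _); apply/matrixP => i j; rewrite !mxE fg. Qed.

Lemma det_enum T n (h : 'I_n -> T) (f : T -> T -> R) :
  bijective h -> \det (\matrix_(i, j) f (h i) (h j)) = fin_det f.
Proof.
move=> bij_h; have n_eq : n = #|T| by rewrite -(bij_eq_card bij_h) card_ord.
subst n; have inj_s : injective (fun i => enum_rank (h i)).
  by move=> i j /enum_rank_inj /(bij_inj bij_h).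
pose s := perm inj_s.
have -> : (\matrix_(i, j) f (h i) (h j)) = row_perm s (col_perm s (fin_mx f)).
  by apply/matrixP => i j; rewrite !mxE !permE !enum_rankK.
rewrite row_permE col_permE !det_mulmx mulrCA -det_mulmx -perm_mxM.
by rewrite mulgV perm_mx1 det1 mulr1.
Qed.

Lemma fin_det_reindex T1 T2 (h : T1 -> T2) (f : T2 -> T2 -> R) :
  bijective h -> fin_det (fun x y => f (h x) (h y)) = fin_det f.
Proof.
move=> bij_h; rewrite -(@det_enum _ _ (fun i : 'I_#|T1| => h (enum_val i))) //.
exact: bij_comp bij_h (@enum_val_bij T1).
Qed.

Lemma fin_det_sum T1 T2 (f : T1 + T2 -> T1 + T2 -> R) :
  fin_det f = \det (block_mx
    (\matrix_(i < #|T1|, j < #|T1|) f (inl (enum_val i)) (inl (enum_val j)))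
    (\matrix_(i < #|T1|, j < #|T2|) f (inl (enum_val i)) (inr (enum_val j)))
    (\matrix_(i < #|T2|, j < #|T1|) f (inr (enum_val i)) (inl (enum_val j)))
    (\matrix_(i < #|T2|, j < #|T2|) f (inr (enum_val i)) (inr (enum_val j)))).
Proof.
pose h (i : 'I_(#|T1| + #|T2|)) : T1 + T2 :=
  match split i with inl j => inl (enum_val j) | inr j => inr (enum_val j) end.
have bij_h : bijective h.
  exists (fun x => match x with
     inl y => lshift _ (enum_rank y) | inr y => rshift _ (enum_rank y) end).
    by move=> i; rewrite /h; case: splitP => j ij; apply: val_inj;
      rewrite /= enum_valK.
  case=> y; rewrite /h.
    by rewrite (unsplitK (inl _)) enum_rankK.
  by rewrite (unsplitK (inr _)) enum_rankK.
rewrite -(det_enum f bij_h); congr (\det _).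
apply/matrixP => i j; rewrite -(splitK i) -(splitK j).
by case: (split i) => i'; case: (split j) => j' /=;
  rewrite ?(block_mxEul, block_mxEur, block_mxEdl, block_mxEdr) !mxE /h
  ?(unsplitK (inl _)) ?(unsplitK (inr _)).
Qed.

(** The solution [Y] of [f22 Y = f21] replaces the inverse of the block [f22]: a
column operation with [Y] clears the lower left block, so [f22] need not be
invertible and the base ring need not be a field. *)
Lemma fin_det_schur T1 T2 (f : T1 + T2 -> T1 + T2 -> R) (Y : T2 -> T1 -> R) :
  (forall y x, f (inr y) (inl x) = \sum_z f (inr y) (inr z) * Y z x) ->
  fin_det f = fin_det (fun y z => f (inr y) (inr z)) *
    fin_det (fun x x' => f (inl x) (inl x') -
                         \sum_z f (inl x) (inr z) * Y z x').
Proof.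
move=> fY; rewrite fin_det_sum.
set A := (X in block_mx X _ _ _); set B := (X in block_mx _ X _ _).
set C := (X in block_mx _ _ X _); set D := (X in block_mx _ _ _ X).
pose M : 'M_(_, _) := \matrix_(i < #|T2|, j < #|T1|) Y (enum_val i) (enum_val j).
have sumT2 (F : T2 -> R) : \sum_z F z = \sum_(i < #|T2|) F (enum_val i).
  by rewrite (reindex (enum_val (A := T2))) //; apply: onW_bij;
     apply: enum_val_bij.
have CE : C = D *m M.
  by apply/matrixP => i j; rewrite !mxE fY sumT2; apply: eq_bigr => k _; rewrite !mxE.
have -> : block_mx A B C D =
   block_mx (A - B *m M) B 0 D *m block_mx 1%:M 0 M 1%:M.
  by rewrite mulmx_block !mulmx1 !mulmx0 !add0r subrK CE.
rewrite det_mulmx det_ublock det_lblock !det1 !mulr1 mulrC; congr (_ * _).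
congr (\det _); apply/matrixP => i j; rewrite !mxE sumT2; congr (_ - _).
by apply: eq_bigr => k _; rewrite !mxE.
Qed.

Lemma fin_det_swap T1 T2 (f : T1 + T2 -> T1 + T2 -> R) :
  fin_det f = fin_det (fun x y : T2 + T1 =>
    f (match x with inl a => inr a | inr b => inl b end)
      (match y with inl a => inr a | inr b => inl b end)).
Proof.
symmetry; apply: (fin_det_reindex (h := fun x : T2 + T1 =>
  match x with inl a => inr a | inr b => inl b end)).
by exists (fun x : T1 + T2 => match x with inl a => inr a | inr b => inl b end);
  case.
Qed.

Lemma fin_det_scalar T (a : R) : fin_det (fun x y : T => a *+ (x == y)) = a ^+ #|T|.
Proof.
rewrite -det_scalar; congr (\det _); apply/matrixP => i j.
by rewrite !mxE (inj_eq enum_val_inj).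
Qed.

Lemma fin_det_scale T (u w : T -> R) (f : T -> T -> R) :
  fin_det (fun x y => u x * f x y * w y) =
    (\prod_x u x) * fin_det f * \prod_x w x.
Proof.
have prodT (F : T -> R) : \prod_z F z = \prod_(i < #|T|) F (enum_val i).
  by rewrite (reindex (enum_val (A := T))) //; apply: onW_bij;
     apply: enum_val_bij.
have -> : fin_det (fun x y => u x * f x y * w y) = \det (
   diag_mx (\row_i u (enum_val i)) *m fin_mx f *m diag_mx (\row_i w (enum_val i))).
  congr (\det _); apply/matrixP => i j.
  by rewrite mul_mx_diag mul_diag_mx !mxE.
rewrite !det_mulmx !det_diag !prodT; congr (_ * _ * _);
  by apply: eq_bigr => i _; rewrite !mxE.
Qed.

(** By induction on the number of blocks, after numbering them: each step splits
off one block of a block diagonal matrix. *)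
Lemma fin_det_kron T1 T2 (g : T2 -> T2 -> R) :
  fin_det (fun x y : T1 * T2 => g x.2 y.2 *+ (x.1 == y.1)) = fin_det g ^+ #|T1|.
Proof.
have ind n : fin_det (fun x y : 'I_n * T2 => g x.2 y.2 *+ (x.1 == y.1))
    = fin_det g ^+ n.
  elim: n => [|n IHn].
    rewrite expr0 /fin_det; move: (fin_mx _); rewrite card_prod card_ord mul0n.
    exact: det_mx00.
  pose h (x : T2 + 'I_n * T2) : 'I_n.+1 * T2 :=
    match x with inl b => (ord0, b) | inr (i, b) => (lift ord0 i, b) end.
  have bij_h : bijective h.
    exists (fun x => if unlift ord0 x.1 is Some i then inr (i, x.2) else inl x.2).
      by case=> [b|[i b]] /=; rewrite ?unlift_none ?liftK.
    by case=> i b /=; case: unliftP => [j ->|->].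
  rewrite -(fin_det_reindex _ bij_h) (@fin_det_schur _ _ _ (fun _ _ => 0)).
    rewrite exprSr; congr (_ * _).
      rewrite -IHn; apply: eq_fin_det => -[i b] [j c] /=.
      by rewrite (inj_eq lift_inj).
    by apply: eq_fin_det => b c; rewrite /= big1 ?subr0 // => z _; rewrite mulr0.
  by case=> i b c /=; rewrite big1 // => z _; rewrite mulr0.
rewrite -ind -(@fin_det_reindex _ _ (fun x : 'I_#|T1| * T2 => (enum_val x.1, x.2))).
  by apply: eq_fin_det => x y /=; rewrite (inj_eq enum_val_inj).
exists (fun x : T1 * T2 => (enum_rank x.1, x.2)) => -[a b] /=.
  by rewrite enum_valK.
by rewrite enum_rankK.
Qed.
End DetT.

(** * Sylvester's determinant identity *)

Section Sylvester.
Variable R : comNzRingType.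

Lemma sum_delta (T : finType) (F : T -> R) a (x : T) :
  \sum_z a *+ (x == z) * F z = a * F x.
Proof.
rewrite (bigD1 x) //= eqxx big1 ?addr0 // => z /negPf zx.
by rewrite eq_sym zx mul0r.
Qed.

(** Both sides are Schur complements of the block matrix with blocks [1], [B],
[C] and [a]; for the right-hand side the first block of columns is scaled by [a]
beforehand, which makes the second diagonal block divide the lower left one. *)
Lemma fin_det_sylvester (T1 T2 : finType) (a : R)
    (B : T1 -> T2 -> R) (C : T2 -> T1 -> R) :
  a ^+ #|T1| * fin_det (fun y z => a *+ (y == z) - \sum_x C y x * B x z) =
  a ^+ #|T2| * fin_det (fun x w => a *+ (x == w) - \sum_y B x y * C y w).
Proof.
pose f (p q : T1 + T2) := match p, q with
  | inl x, inl w => 1 *+ (x == w)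
  | inl x, inr z => B x z
  | inr y, inl w => C y w
  | inr y, inr z => a *+ (y == z) end.
have -> : fin_det (fun y z => a *+ (y == z) - \sum_x C y x * B x z) = fin_det f.
  rewrite fin_det_swap (fin_det_schur (Y := B)) /=.
    by rewrite fin_det_scalar expr1n mul1r.
  by move=> x z; rewrite sum_delta mul1r.
(* [w] multiplies the columns indexed by [T1] by [a] *)
pose w (q : T1 + T2) := if q is inl _ then a else 1.
have -> : a ^+ #|T1| = \prod_q w q.
  by rewrite big_sumType /= prodr_const big1 ?mulr1 //; congr (_ ^+ _); apply: eq_card.
have := fin_det_scale (fun _ => 1) w f.
rewrite big1 // mul1r mulrC => <-.
rewrite (fin_det_schur (Y := C)) /=.
  rewrite -fin_det_scalar; congr (_ * _).
    by apply: eq_fin_det => y z; rewrite mul1r mulr1.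
  apply: eq_fin_det => x z; rewrite mul1r mulrnAl mul1r; congr (_ - _).
  by apply: eq_bigr => y _; rewrite mul1r mulr1.
move=> y x; rewrite mul1r mulrC -(@sum_delta _ (C^~ x) a y).
by apply: eq_bigr => z _; rewrite mul1r mulr1.
Qed.
End Sylvester.

(** * Spectra and characteristic polynomials *)

Section Roots.
Variable R : rcfType.

Lemma roots_of_monic (p : {poly R}) s :
  p \is monic -> (roots_of p s <-> p = \prod_(x <- s) ('X - x%:P)).
Proof.
move=> mp; rewrite /roots_of (monicP mp) scale1r.
by split=> [[]|pE] //; rewrite monic_neq0.
Qed.

Lemma spectrumE n (A : 'M[R]_n) s :
  is_spectrum A s <-> char_poly A = \prod_(x <- s) ('X - x%:P).
Proof. exact: roots_of_monic (char_poly_monic A). Qed.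

Lemma size_spectrum n (A : 'M[R]_n) s : is_spectrum A s -> size s = n.
Proof.
move/spectrumE => A_s; have := size_char_poly A.
by rewrite A_s size_prod_XsubC => -[].
Qed.

Lemma char_poly_horner n (A : 'M[R]_n) x : (char_poly A).[x] = \det (x%:M - A).
Proof.
rewrite -horner_evalE -det_map_mx; congr (\det _).
apply/matrixP => i j; rewrite !mxE.
by rewrite /= /horner_eval hornerD hornerN hornerMn hornerX hornerC.
Qed.

(** For nonzero [b] this is the characteristic polynomial at [- a / b], rescaled. *)
Lemma det_affine n (A : 'M[R]_n) s a b : is_spectrum A s ->
  \det (a%:M + b *: A) = \prod_(t <- s) (a + b * t).
Proof.
move=> A_s; have sz := size_spectrum A_s; move/spectrumE: A_s => A_s.
have [->|b0] := eqVneq b 0.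
  rewrite scale0r addr0 det_scalar -sz.
  by under eq_bigr do rewrite mul0r addr0; rewrite big_const_seq count_predT iter_mulr_1.
have -> : a%:M + b *: A = (- b) *: ((- (a / b))%:M - A).
  by rewrite scalerBr scale_scalar_mx mulrNN mulrCA divff // mulr1 scaleNr opprK.
rewrite detZ -char_poly_horner A_s horner_prod -sz.
rewrite -[size s]count_predT -iter_mulr_1 -big_const_seq -big_split /=.
apply: eq_bigr => t _; rewrite hornerXsubC mulrBr mulrNN mulrCA divff // mulr1.
by rewrite mulNr opprK.
Qed.

(** Over the complex closure a real symmetric matrix is Hermitian, hence
unitarily diagonalizable with real eigenvalues; the factorization of its
characteristic polynomial descends because the embedding is injective. *)
Lemma symmetric_spectrum n (A : 'M[R]_n) : A^T = A -> exists s, is_spectrum A s.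
Proof.
move=> symA; pose B := map_mx (real_complex R) A.
have hermB : B \is hermsymmx.
  apply/is_hermitianmxP; rewrite expr0 scale1r.
  apply/matrixP => i j; rewrite !mxE -{1}symA mxE.
  by rewrite conj_Creal //; apply/complex_realP; exists (A j i).
have realD := hermitian_spectral_diag_real hermB.
have /orthomx_spectralP := hermitian_normalmx hermB.
have := unitarymx_unit (spectral_unitarymx B).
move: (spectralmx B) (spectral_diag B) realD => P d /mxOverP d_real P_unit BE.
pose s := [seq complex.Re (d 0 i) | i <- enum 'I_n].
exists s; apply/spectrumE/(map_poly_inj (real_complex R)).
rewrite map_char_poly -/B BE map_prod_XsubC big_map big_enum /=.
pose Q := map_mx polyC P; pose Q' := map_mx polyC (invmx P).
have Q'Q : Q' *m Q = 1%:M by rewrite -map_mxM mulVmx // map_mx1.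
have -> : char_poly (invmx P *m diag_mx d *m P) = char_poly (diag_mx d).
  rewrite /char_poly.
  have -> : char_poly_mx (invmx P *m diag_mx d *m P) =
      Q' *m char_poly_mx (diag_mx d) *m Q.
    rewrite /char_poly_mx mulmxBr mulmxBl !map_mxM; congr (_ - _).
    by rewrite mul_mx_scalar -scalemxAl Q'Q scalemx1.
  by rewrite !det_mulmx mulrAC -det_mulmx Q'Q det1 mul1r.
rewrite char_poly_trig ?diag_mx_is_trig //; apply: eq_bigr => i _.
by rewrite mxE eqxx mulr1n /= RRe_real.
Qed.
End Roots.

(** * Incidence counts and degrees in the corona *)

Lemma degree_sum (G : sgraph) (v : G) : degree v = (\sum_(w : G) adj v w)%N.
Proof.
by rewrite /degree -sum1dep_card big_mkcond; apply: eq_bigr => w _; case: adj.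
Qed.

Section Incidence.
Variable G : sgraph.
Implicit Types (v w : G) (e : edge_type G).

Lemma adj_neq v w : adj v w -> v != w.
Proof. by apply: contraTneq => ->; rewrite adj_irr. Qed.

Lemma edges_pair v w : ([set v; w] \in edges G) = adj v w.
Proof.
apply/imsetP/idP => [[[a b]]|vw]; last by exists (v, w); rewrite ?inE.
rewrite inE /= => ab E.
have /set2P va : v \in [set a; b] by rewrite -E set21.
have /set2P wa : w \in [set a; b] by rewrite -E set22.
have /set2P av : a \in [set v; w] by rewrite E set21.
have /set2P bv : b \in [set v; w] by rewrite E set22.
have ba : adj b a by rewrite adj_sym.
have := adj_neq ab.
case: va => ?; case: wa => ?; subst v w => //.
  by case: bv => ->; rewrite eqxx.
by case: av => ->; rewrite eqxx.
Qed.

Lemma card_edge e : #|val e| = 2%N.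
Proof.
case/imsetP: (valP e) => -[a b]; rewrite inE /= => ab ->.
by rewrite cards2 (adj_neq ab).
Qed.

(** The matrix identity [B B^T = D + A]: two distinct vertices lie in a common
edge only if that edge is the pair they form. *)
Lemma sum_incidence v w :
  (\sum_(e : edge_type G) (v \in val e) * (w \in val e) =
   degree v * (v == w) + adj v w)%N.
Proof.
rewrite -(big_sub _ (fun e : {set G} => (v \in e) * (w \in e))%N) /=.
have [<-|vw] := eqVneq v w.
  rewrite adj_irr muln1 addn0.
  pose N := [set [set v; u] | u in [set u : G | adj v u]].
  have -> : degree v = #|N|.
    rewrite card_in_imset // => a b; rewrite !inE => /adj_neq va /adj_neq vb E.
    have /set2P [av|//] : a \in [set v; b] by rewrite -E set22.
    by rewrite av eqxx in va.
  rewrite -sum1_card big_mkcond [RHS]big_mkcond /=; apply: eq_bigr => e _.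
  have [/imsetP[u]|no] := boolP (e \in N); first rewrite inE => vu ->.
    by rewrite edges_pair vu set21.
  case: ifP => // /imsetP[[a b]]; rewrite inE /= => ab eE.
  case: (boolP (v \in e)) => // ve; case/imsetP: no.
  move: ve; rewrite eE => /set2P[->|->].
    by exists b; rewrite ?inE.
  by exists a; rewrite ?inE 1?adj_sym // setUC.
rewrite muln0 add0n -edges_pair.
have [vw_e|vw_e] := boolP ([set v; w] \in edges G); last first.
  rewrite big1 // => e e_edge; case: (boolP (v \in e)) => // ve.
  case: (boolP (w \in e)) => // we; case/negP: vw_e.
  rewrite -(_ : e = [set v; w]) //; apply/esym/eqP.
  rewrite eqEcard subUset !sub1set ve we cards2 vw /=.
  by rewrite -(card_edge (Sub e e_edge)).
rewrite (bigD1 _ vw_e) /= set21 set22 big1 // => e /andP[e_edge ne].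
case: (boolP (v \in e)) => // ve; case: (boolP (w \in e)) => // we; case/eqP: ne.
apply/esym/eqP; rewrite eqEcard subUset !sub1set ve we cards2 vw /=.
by rewrite -(card_edge (Sub e e_edge)).
Qed.

Lemma sum_incident_edges v : (\sum_(e : edge_type G) (v \in val e) = degree v)%N.
Proof.
have := sum_incidence v v; rewrite eqxx muln1 adj_irr addn0 => <-.
by apply: eq_bigr => e _; case: (v \in _).
Qed.

Lemma sum_endpoints e : (\sum_v (v \in val e) = 2)%N.
Proof.
rewrite -(card_edge e) -sum1_card [RHS]big_mkcond /=.
by apply: eq_bigr => v _; case: (v \in _).
Qed.
End Incidence.

Section CoronaDegree.
Variables (G1 G2 G3 : sgraph) (r1 r2 r3 : nat).
Hypotheses (reg1 : regular r1 G1) (reg2 : regular r2 G2) (reg3 : regular r3 G3).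
Local Notation C := (corona G1 G2 G3).

Lemma sum_eq_op (T : finType) (x : T) : (\sum_y (x == y) = 1)%N.
Proof. by rewrite (bigD1 x) //= eqxx big1 // => y; rewrite eq_sym => /negPf->. Qed.

Lemma sum_pair_fst (T U : finType) (F : T -> nat) :
  (\sum_(x : T * U) F x.1 = (\sum_x F x) * #|U|)%N.
Proof.
rewrite -(pair_bigA _ (fun x _ => F x)) /= big_distrl /=.
by apply: eq_bigr => x _; rewrite sum_nat_const mulnC.
Qed.

Lemma degree_corona_vertex (v : G1) : degree (inl (inl (inl v)) : C) = r1.
Proof.
rewrite degree_sum /= 3!big_sumType /= big1 // add0n sum_incident_edges reg1.
by rewrite !big1 ?addn0 // => -[].
Qed.

Lemma sum_pair_delta (T U : finType) (x : T) (F : U -> bool) :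
  (\sum_(p : T * U) ((x == p.1) && F p.2) = \sum_y F y)%N.
Proof.
rewrite -(pair_bigA _ (fun a y => ((x == a) && F y : nat))) (bigD1 x) //=.
rewrite eqxx [X in (_ + X)%N]big1 ?addn0 // => a; rewrite eq_sym => /negPf->.
by rewrite big1.
Qed.

Lemma degree_corona_edge (e : edge_type G1) :
  degree (inl (inl (inr e)) : C) = (2 + 2 * #|G2| + #|G3|)%N.
Proof.
rewrite degree_sum /= 3!big_sumType /= [X in (_ + X + _ + _)%N]big1 // addn0.
rewrite (sum_endpoints e); congr (_ + _ + _)%N.
  rewrite -[in RHS](sum_endpoints e) -sum_pair_fst.
  by apply: eq_bigr => -[].
rewrite -[RHS]mul1n -[in RHS](sum_eq_op e) -sum_pair_fst.
by apply: eq_bigr => -[].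
Qed.

Lemma degree_corona_copy2 (v : G1) (u : G2) :
  degree (inl (inr (v, u)) : C) = (r1 + r2)%N.
Proof.
rewrite degree_sum /= 3!big_sumType /= sum_incident_edges reg1.
rewrite [X in (X + _ + _ + _)%N]big1 // [X in (_ + X)%N]big1 // add0n addn0.
rewrite -[in RHS](reg2 u) degree_sum -(sum_pair_delta v); congr (_ + _)%N.
by apply: eq_bigr => -[].
Qed.

Lemma degree_corona_copy3 (e : edge_type G1) (w : G3) :
  degree (inr (e, w) : C) = (r3 + 1)%N.
Proof.
rewrite degree_sum /= 3!big_sumType /= [X in (X + _ + _ + _)%N]big1 //.
rewrite [X in (_ + X + _)%N]big1 // add0n addn0 addnC.
rewrite -[in RHS](reg3 w) degree_sum -(sum_pair_delta e) -[in RHS](sum_eq_op e).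
congr (_ + _)%N; first by apply: eq_bigr => -[].
by apply: eq_bigr => e' _; rewrite eq_sym.
Qed.
End CoronaDegree.

(** * Normalized Laplacians *)

Section Lap.
Variables (R : rcfType) (G : sgraph).
Implicit Types u v : G.

Definition laplacian_fun u v : R :=
  if isolated u || isolated v then 0
  else (u == v)%:R -
    (Num.sqrt (degree u)%:R)^-1 * (adj u v)%:R * (Num.sqrt (degree v)%:R)^-1.

Lemma laplacian_fin_mx : normalized_laplacian R G = fin_mx laplacian_fun.
Proof.
rewrite /normalized_laplacian /inv_sqrt_degree_mx mul_mx_diag mul_diag_mx.
apply/matrixP => i j; rewrite !mxE /laplacian_fun; case: ifP => // _.
by rewrite (inj_eq enum_val_inj).
Qed.

Lemma laplacian_sym : (normalized_laplacian R G)^T = normalized_laplacian R G.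
Proof.
apply/matrixP => i j; rewrite laplacian_fin_mx !mxE /laplacian_fun orbC eq_sym.
by rewrite adj_sym; case: ifP => // _; congr (_ - _); rewrite mulrC mulrA mulrAC.
Qed.

Lemma laplacian_spectrum : exists s, is_spectrum (normalized_laplacian R G) s.
Proof. exact: symmetric_spectrum laplacian_sym. Qed.

(** Multiply [x - L] by [D^(1/2)] on both sides; without isolated vertices the
exceptional clause of the definition of [L] never applies. *)
Lemma char_poly_laplacian x : (forall v, ~~ isolated v) ->
  (\prod_(v : G) (degree v)%:R) * (char_poly (normalized_laplacian R G)).[x] =
  fin_det (fun u v => ((x - 1) * (degree u)%:R) *+ (u == v) + (adj u v)%:R).
Proof.
move=> noniso; rewrite char_poly_horner laplacian_fin_mx.
pose q v : R := Num.sqrt (degree v)%:R.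
have q0 v : q v != 0.
  by rewrite gt_eqF // sqrtr_gt0 ltr0n lt0n; apply: noniso.
have qq v : q v * q v = (degree v)%:R by rewrite -expr2 sqr_sqrtr ?ler0n.
have -> : \prod_(v : G) (degree v)%:R = (\prod_v q v) * \prod_v q v.
  by rewrite -big_split; apply: eq_bigr => v _; rewrite /= qq.
have -> : \det (x%:M - fin_mx laplacian_fun) =
    fin_det (fun u v => x *+ (u == v) - laplacian_fun u v).
  congr (\det _); apply/matrixP => i j.
  by rewrite !mxE (inj_eq enum_val_inj).
rewrite mulrAC -fin_det_scale; apply: eq_fin_det => u v.
rewrite /laplacian_fun (negPf (noniso u)) (negPf (noniso v)) /= -/(q u) -/(q v).
have [<-|uv] := eqVneq u v.
  rewrite adj_irr mulr0 mul0r subr0 addr0 !mulr1n -qq; ring.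
by rewrite !mulr0n !sub0r opprK add0r; field; rewrite !q0.
Qed.
End Lap.

Section RegularLap.
Variables (R : rcfType) (G : sgraph) (r : nat) (regG : regular r G).
Implicit Types u v : G.

(** Multiplying by [r] avoids dividing by the degree, so that the formula
also covers edgeless graphs, whose Laplacian is zero by convention. *)
Lemma regular_laplacian u v :
  r%:R * laplacian_fun R u v = r%:R *+ (u == v) - (adj u v)%:R.
Proof.
rewrite /laplacian_fun /isolated !regG orbb; case: eqP => [r0|/eqP r0].
  have /eqP := regG u; rewrite r0 degree_sum sum_nat_eq0 => /forallP /(_ v).
  by rewrite mul0r mul0rn; case: adj; rewrite //= subrr.
have sq : Num.sqrt r%:R * Num.sqrt r%:R = r%:R :> R.
  by rewrite -expr2 sqr_sqrtr ?ler0n.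
have s0 : Num.sqrt r%:R != 0 :> R by rewrite gt_eqF // sqrtr_gt0 ltr0n lt0n.
rewrite mulrBr -[r%:R *+ (u == v)]mulr_natr -[X in _ - X * _]sq.
move: (Num.sqrt _ : R) (adj u v)%:R s0 => q a q0; congr (_ - _).
by field.
Qed.

(** Substitute [A = r (1 - L)]. *)
Lemma fin_det_regular s a b : is_spectrum (normalized_laplacian R G) s ->
  fin_det (fun u v => a *+ (u == v) + b * (adj u v)%:R) =
  \prod_(t <- s) (a + b * r%:R * (1 - t)).
Proof.
move=> G_s; have := det_affine (a + b * r%:R) (- (b * r%:R)) G_s.
rewrite laplacian_fin_mx => detE.
under eq_bigr do rewrite mulrBr mulr1 addrA -mulNr.
rewrite -detE; congr (\det _); apply/matrixP => i j.
rewrite !mxE mulNr -mulrA regular_laplacian (inj_eq enum_val_inj).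
by case: eqP => _; rewrite ?mulr1n ?mulr0n; ring.
Qed.

Lemma sum_adj_regular v : \sum_(u : G) (adj u v)%:R = r%:R :> R.
Proof.
rewrite -natr_sum -(regG v) degree_sum; congr (_%:R).
by apply: eq_bigr => u _; rewrite adj_sym.
Qed.

Lemma isolated_laplacian u v : r = 0%N -> laplacian_fun R u v = 0.
Proof. by move=> r0; rewrite /laplacian_fun /isolated regG r0. Qed.

(** Gershgorin's argument at a vertex where the eigenvector has maximal modulus
gives [`|1 - t| <= 1]. *)
Lemma regular_spectrum_ge0 s t : is_spectrum (normalized_laplacian R G) s ->
  t \in s -> 0 <= t.
Proof.
move=> /spectrumE G_s ts.
have /eigenvalueP[x xL x0] : eigenvalue (normalized_laplacian R G) t.
  by rewrite eigenvalue_root_char G_s root_prod_XsubC.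
pose f (u : G) := x 0 (enum_rank u).
have fL u : \sum_w f w * laplacian_fun R w u = t * f u.
  move/matrixP/(_ 0 (enum_rank u)): xL; rewrite laplacian_fin_mx !mxE => <-.
  rewrite (reindex _ (onW_bij _ (enum_val_bij G))) /=.
  by apply: eq_bigr => i _; rewrite mxE enum_rankK /f enum_valK.
have [i xi] : exists i, x 0 i != 0.
  by apply/existsP; apply: contraNT x0 => /existsPn h; apply/eqP/rowP => i;
     rewrite mxE; apply/eqP; rewrite -[_ == _]negbK h.
pose m := [arg max_(u > enum_val i) `|f u|]%O.
have f_max u : `|f u| <= `|f m|.
  by rewrite /m; case: arg_maxP => //= w _; apply.
have fm_gt0 : 0 < `|f m|.
  by apply: lt_le_trans (f_max (enum_val i)); rewrite normr_gt0 /f enum_valK.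
have [r0|r_gt0] := posnP r.
  have := fL m; rewrite big1 => [/esym/eqP|w _]; last first.
    by rewrite isolated_laplacian ?mulr0.
  by rewrite mulf_eq0 -[f m == 0]normr_eq0 (gt_eqF fm_gt0) orbF => /eqP->.
have adjE : r%:R * (1 - t) * f m = \sum_w f w * (adj w m)%:R.
  rewrite mulrBr mulr1 mulrBl -mulrA -fL mulr_sumr.
  under eq_bigr do rewrite mulrCA regular_laplacian mulrBr mulrnAr.
  rewrite sumrB (bigD1 m) //= eqxx mulr1n big1 ?addr0 => [|w /negPf->] //.
  by rewrite [f m * _]mulrC opprB addrC subrK.
have : `|1 - t| <= 1.
  rewrite -(ler_pM2l (x := r%:R * `|f m|)) ?mulr_gt0 ?ltr0n // mulr1.
  rewrite -[r%:R]ger0_norm ?ler0n // -!normrM mulrAC adjE.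
  apply: le_trans (ler_norm_sum _ _ _) _.
  rewrite normrM ger0_norm ?ler0n // -(sum_adj_regular m) mulr_suml.
  apply: ler_sum => w _; rewrite normrM normr_nat mulrC.
  by apply: ler_wpM2l; rewrite ?ler0n.
by rewrite ler_norml => /andP[_]; rewrite gerBl.
Qed.

(** The all-one vector is in the kernel. *)
Lemma regular_spectrum0 s : is_spectrum (normalized_laplacian R G) s ->
  (0 < #|G|)%N -> 0 \in s.
Proof.
move=> /spectrumE G_s G_gt0.
rewrite -root_prod_XsubC -G_s -eigenvalue_root_char.
apply/eigenvalueP; exists (const_mx 1); last first.
  apply/eqP => /rowP /(_ (Ordinal G_gt0)); rewrite !mxE => /eqP.
  by rewrite oner_eq0.
rewrite scale0r laplacian_fin_mx; apply/rowP => j; rewrite !mxE.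
under eq_bigr do rewrite !mxE mul1r.
move: (enum_val j) => v {j}.
have <- : \sum_u laplacian_fun R u v =
    \sum_(i < #|G|) laplacian_fun R (enum_val i) v.
  by rewrite (reindex _ (onW_bij _ (enum_val_bij G))).
have [r0|r_gt0] := posnP r; first by rewrite big1 // => u; rewrite isolated_laplacian.
apply: (mulfI (x := r%:R)); first by rewrite pnatr_eq0 -lt0n.
rewrite mulr0 mulr_sumr; under eq_bigr do rewrite regular_laplacian.
rewrite sumrB sum_adj_regular (bigD1 v) //= eqxx big1 ?addr0 ?subrr //.
by move=> u /negPf->.
Qed.

Lemma regular_last_eigenvalue s : is_spectrum (normalized_laplacian R G) s ->
  (0 < #|G|)%N -> sorted >=%R s -> s`_(#|G|.-1) = 0.
Proof.
move=> G_s G_gt0 s_sorted; have sz := size_spectrum G_s.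
have i_lt : (#|G|.-1 < size s)%N by rewrite sz ltn_predL.
apply/le_anti; rewrite (regular_spectrum_ge0 G_s (mem_nth _ i_lt)) andbT.
have s0 := regular_spectrum0 G_s G_gt0.
rewrite -[leRHS](nth_index 0 s0).
apply: (sorted_leq_nth (leT := >=%R)) => //.
- by move=> a b c ba cb; apply: le_trans cb ba.
- by move=> a /=.
- by rewrite inE index_mem.
by rewrite -ltnS prednK // -sz index_mem.
Qed.
End RegularLap.

(** * The determinant of the corona *)

Section Pendant.
Variable F : fieldType.

(** A graph with a copy of [U] attached to every [t] in [T]: constant row sums
[k] make [c / k], constant on each copy, a solution of the Schur equation. *)
Lemma fin_det_pendant (S T U : finType) (h : S -> S -> F) (c : S -> T -> F)
    (g : U -> U -> F) k :
  k != 0 -> (forall u, \sum_u' g u u' = k) ->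
  fin_det (fun p q : S + T * U => match p, q with
    | inl s, inl s' => h s s'
    | inl s, inr (t, _) => c s t
    | inr (t, _), inl s => c s t
    | inr (t, u), inr (t', u') => g u u' *+ (t == t') end) =
  fin_det g ^+ #|T| *
  fin_det (fun s s' => h s s' - #|U|%:R / k * \sum_t c s t * c s' t).
Proof.
move=> k0 g_sum; rewrite (fin_det_schur (Y := fun p s => c s p.1 / k)) /=.
  rewrite -fin_det_kron; congr (_ * _); first by apply: eq_fin_det => -[? ?] [].
  apply: eq_fin_det => s s'; congr (_ - _).
  transitivity (\sum_(p : T * U) c s p.1 * (c s' p.1 / k)).
    by apply: eq_bigr => -[].
  rewrite -(pair_bigA _ (fun t _ => c s t * (c s' t / k))) /= mulr_sumr.
  apply: eq_bigr => t _; rewrite sumr_const -[LHS]mulr_natl; field.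
  by rewrite k0.
move=> [t u] s.
transitivity (\sum_(p : T * U) g u p.2 *+ (t == p.1) * (c s p.1 / k)); last first.
  by apply: eq_bigr => -[].
rewrite -(pair_bigA _ (fun t' u' => g u u' *+ (t == t') * (c s t' / k))) /=.
rewrite (bigD1 t) //= eqxx [X in _ + X]big1 ?addr0.
  by rewrite -mulr_suml g_sum mulrCA divff // mulr1.
by move=> t' /negPf; rewrite eq_sym => tt'; rewrite big1 // => u' _; rewrite tt' mul0r.
Qed.

End Pendant.

Section Incid.
Variables (R : rcfType) (G : sgraph) (r : nat) (regG : regular r G).

(** Eliminate the vertices, pass from the edges back to the vertices by
Sylvester's identity, and use the identity [B B^T = r I + A]. *)
Lemma fin_det_incidence s (al a b : R) :
  is_spectrum (normalized_laplacian R G) s -> al != 0 ->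
  a ^+ #|G| * fin_det (fun p q : G + edge_type G => match p, q with
    | inl v, inl w => al *+ (v == w)
    | inl v, inr e => (v \in val e)%:R
    | inr e, inl v => (v \in val e)%:R
    | inr e, inr e' => a *+ (e == e')
        - b * \sum_(v : G) (v \in val e)%:R * (v \in val e')%:R end) =
  al ^+ #|G| * a ^+ #|edge_type G| *
  \prod_(t <- s) (a - (b + al^-1) * r%:R * (2 - t)).
Proof.
move=> G_s al0; pose B v (e : edge_type G) : R := (v \in val e)%:R.
rewrite fin_det_swap (fin_det_schur (Y := fun v e => B v e / al)) /=; last first.
  move=> v e; rewrite (sum_delta (fun v => B v e / al)).
  by rewrite mulrCA divff // mulr1.
rewrite fin_det_scalar -mulrA mulrCA; congr (_ * _).
pose c := b + al^-1.
transitivity (a ^+ #|G| * fin_det (fun e e' : edge_type G =>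
    a *+ (e == e') - \sum_v B v e * (c * B v e'))).
  congr (_ * _); apply: eq_fin_det => e e'; rewrite -addrA -opprD; congr (_ - _).
  rewrite mulr_sumr -big_split; apply: eq_bigr => v _ /=.
  by rewrite -/(B v e) -/(B v e') /c; ring.
rewrite (fin_det_sylvester a (fun v e => c * B v e) (fun e v => B v e)).
congr (_ * _).
under [RHS]eq_bigr => t _.
  have -> : a - c * r%:R * (2 - t) = (a - c * r%:R) + (- c) * r%:R * (1 - t) by ring.
  over.
rewrite -(fin_det_regular regG _ _ G_s); apply: eq_fin_det => v w.
under eq_bigr do rewrite -mulrA -natrM.
rewrite -mulr_sumr -natr_sum sum_incidence regG natrD natrM.
by case: eqP => _; rewrite ?mulr1n ?mulr0n; ring.
Qed.

End Incid.

Section CoronaDet.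
Variables (R : rcfType) (G1 G2 G3 : sgraph) (r1 r2 r3 : nat).
Hypotheses (reg1 : regular r1 G1) (reg2 : regular r2 G2) (reg3 : regular r3 G3).
Local Notation C := (corona G1 G2 G3).
Local Notation n1 := #|G1|.
Local Notation n2 := #|G2|.
Local Notation n3 := #|G3|.
Local Notation m1 := #|edge_type G1|.

Lemma kron_entry (T U : eqType) (y : R) (t t' : T) (u u' : U) (h : bool) :
  y *+ ((t, u) == (t', u')) + ((t == t') && h)%:R =
  (y *+ (u == u') + h%:R) *+ (t == t').
Proof.
by rewrite xpair_eqE; case: eqP; rewrite //= !mulr0n addr0.
Qed.

(** The copies of [G3] are removed first, then those of [G2], then the matrix on
the subdivision graph is treated by [fin_det_incidence].  Here [E] and [F] are
the row sums of the blocks of a copy of [G3] and of [G2]. *)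
Lemma fin_det_corona theta mu eta (y : R) :
  is_spectrum (normalized_laplacian R G1) theta ->
  is_spectrum (normalized_laplacian R G2) mu ->
  is_spectrum (normalized_laplacian R G3) eta ->
  let F := y * (r1 + r2)%:R + r2%:R in
  let E := y * (r3 + 1)%:R + r3%:R in
  let a := y * (2 + 2 * n2 + n3)%:R - n3%:R / E in
  y * r1%:R != 0 -> F != 0 -> E != 0 ->
  a ^+ n1 * fin_det (fun p q : C =>
    (y * (degree p)%:R) *+ (p == q) + (adj p q)%:R) =
  (\prod_(t <- mu) (y * (r1 + r2)%:R + r2%:R * (1 - t))) ^+ n1 *
  (\prod_(t <- eta) (y * (r3 + 1)%:R + r3%:R * (1 - t))) ^+ m1 *
  a ^+ m1 * (y * r1%:R) ^+ n1 *
  \prod_(t <- theta) (a - (n2%:R / F + (y * r1%:R)^-1) * r1%:R * (2 - t)).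
Proof.
move=> G1_s G2_s G3_s F E a yr0 F0 E0.
pose g2 (u u' : G2) : R := (y * (r1 + r2)%:R) *+ (u == u') + (adj u u')%:R.
pose g3 (u u' : G3) : R := (y * (r3 + 1)%:R) *+ (u == u') + (adj u u')%:R.
have g_sum (G : sgraph) r (z : R) (u : G) : regular r G ->
    \sum_u' (z *+ (u == u') + (adj u u')%:R) = z + r%:R.
  move=> regG; rewrite big_split /= -(regG u) degree_sum natr_sum; congr (_ + _).
  by rewrite (bigD1 u) //= eqxx big1 ?addr0 // => w; rewrite eq_sym => /negPf->.
have -> : \prod_(t <- mu) (y * (r1 + r2)%:R + r2%:R * (1 - t)) = fin_det g2.
  under eq_bigr do rewrite -[r2%:R]mul1r.
  rewrite -(fin_det_regular reg2 _ _ G2_s); apply: eq_fin_det => u u'.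
  by rewrite mul1r.
have -> : \prod_(t <- eta) (y * (r3 + 1)%:R + r3%:R * (1 - t)) = fin_det g3.
  under eq_bigr do rewrite -[r3%:R]mul1r.
  rewrite -(fin_det_regular reg3 _ _ G3_s); apply: eq_fin_det => u u'.
  by rewrite mul1r.
pose M (p q : C) : R := (y * (degree p)%:R) *+ (p == q) + (adj p q)%:R.
(* incidence between the attachment points and the copies of [G3] *)
pose c3 (p : subdivision G1 + G1 * G2) (e : edge_type G1) : R :=
  if p is inl s then (s == inr e)%:R else 0.
pose M1 p q := M (inl p) (inl q) - n3%:R / E * \sum_e c3 p e * c3 q e.
have -> : fin_det M = fin_det g3 ^+ m1 * fin_det M1.
  rewrite -(fin_det_pendant (fun p q => M (inl p) (inl q)) c3 E0); last first.
    by move=> u; apply: g_sum.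
  apply: eq_fin_det => -[p|[e w]] [q|[e' w']] //.
  - by rewrite /M /= add0r; case: p => [?|[]].
  - by rewrite /M /= add0r; case: q => [?|[]].
  - by rewrite /M (degree_corona_copy3 _ reg3) kron_entry.
(* a copy of [G2] is attached at the edges incident to its vertex *)
pose c2 (s : subdivision G1) (v : G1) : R := (adj s (inl v : subdivision G1))%:R.
pose M2 (s t : subdivision G1) := M1 (inl s) (inl t) - n2%:R / F * \sum_v c2 s v * c2 t v.
have -> : fin_det M1 = fin_det g2 ^+ n1 * fin_det M2.
  rewrite -(fin_det_pendant (fun p q => M1 (inl p) (inl q)) c2 F0); last first.
    by move=> u; apply: g_sum.
  apply: eq_fin_det => -[p|[e w]] [q|[e' w']] //.
  - rewrite /M1 /M /= add0r big1 ?mulr0 ?subr0 // => e _; by rewrite mulr0.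
  - rewrite /M1 /M /= add0r big1 ?mulr0 ?subr0 // => e1 _; by rewrite mul0r.
  - rewrite /M1 /M (degree_corona_copy2 _ reg1 reg2) kron_entry.
    by rewrite big1 ?mulr0 ?subr0 // => e1 _; rewrite mul0r.
have -> : fin_det M2 = fin_det (fun p q : G1 + edge_type G1 => match p, q with
    | inl v, inl w => (y * r1%:R) *+ (v == w)
    | inl v, inr e => (v \in val e)%:R
    | inr e, inl v => (v \in val e)%:R
    | inr e, inr e' => a *+ (e == e')
        - n2%:R / F * \sum_(v : G1) (v \in val e)%:R * (v \in val e')%:R end).
  apply: eq_fin_det => -[v|e] [w|f]; rewrite /M2 /M1 /c2 /= /M.
  - rewrite (degree_corona_vertex _ _ reg1) /c3 /= addr0.
    by rewrite !big1 ?mulr0 ?subr0 // => ? _; rewrite ?mul0r ?mulr0.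
  - rewrite /c3 /= add0r.
    by rewrite !big1 ?mulr0 ?subr0 // => ? _; rewrite ?mul0r ?mulr0.
  - rewrite /c3 /= add0r.
    by rewrite !big1 ?mulr0 ?subr0 // => ? _; rewrite ?mul0r ?mulr0.
  rewrite degree_corona_edge /c3 /= addr0; congr (_ - _).
  have -> : \sum_e1 (inr e == inr e1 :> subdivision G1)%:R *
      (inr f == inr e1 :> subdivision G1)%:R = (e == f)%:R :> R.
    rewrite (bigD1 e) //= eqxx big1 ?addr0 ?mul1r 1?eq_sym // => e1 ne.
    by rewrite -[inr e == _]/(e == e1) eq_sym (negPf ne) mul0r.
  by rewrite -[inl (inl _) == _]/(e == f) [_ / E * _]mulr_natr -mulrnBl.
rewrite mulrCA [X in _ * X]mulrCA (fin_det_incidence reg1 _ _ G1_s yr0).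
move: (fin_det g3 ^+ _) (fin_det g2 ^+ _) ((y * _) ^+ n1) (a ^+ _) (\prod_(t <- _) _).
by move=> A2 A3 A1 A4 A5; rewrite !mulrA [A2 * _]mulrC (mulrAC (A3 * A2)).
Qed.
End CoronaDet.

(** * Polynomial form of the identity *)

Section Splitting.
Variable R : rcfType.
Implicit Types (p q : {poly R}) (s t : seq R).

(** A real closed field is infinite, so polynomials that agree off the zeros of
a nonzero [b] are equal. *)
Lemma eq_poly_horner (b p q : {poly R}) :
  b != 0 -> (forall x, b.[x] != 0 -> p.[x] = q.[x]) -> p = q.
Proof.
move=> b0 pq; apply/eqP; rewrite -subr_eq0; apply/negPn/negP => d0.
pose P := b * (p - q); pose s := [seq i%:R : R | i <- iota 0 (size P)].
have P0 : P != 0 by rewrite mulf_neq0.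
have s_uniq : uniq s by rewrite map_inj_uniq ?iota_uniq //; apply: (mulrIn (oner_neq0 R)).
have s_roots : all (root P) s.
  apply/allP => x _; rewrite rootE hornerM hornerD hornerN mulf_eq0 subr_eq0.
  by have [//|bx /=] := eqVneq b.[x] 0; rewrite pq.
by have := max_poly_roots P0 s_roots s_uniq; rewrite size_map size_iota ltnn.
Qed.

Definition root_poly s : {poly R} := \prod_(x <- s) ('X - x%:P).

Lemma root_poly_cat s t : root_poly (s ++ t) = root_poly s * root_poly t.
Proof. exact: big_cat. Qed.

Lemma root_poly_flatten n s : root_poly (flatten (nseq n s)) = root_poly s ^+ n.
Proof.
elim: n => [|n IHn]; first by rewrite expr0 /root_poly big_nil.
by rewrite /= root_poly_cat IHn exprS.
Qed.

Lemma root_poly_nseq n a : root_poly (nseq n a) = ('X - a%:P) ^+ n.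
Proof. by rewrite /root_poly big_nseq iter_mulr_1. Qed.

Lemma root_poly_bigcat n (f : 'I_n -> seq R) :
  root_poly (\big[cat/[::]]_(i < n) f i) = \prod_(i < n) root_poly (f i).
Proof.
by apply: (big_morph root_poly root_poly_cat); rewrite /root_poly big_nil.
Qed.

(** Unique factorization. *)
Lemma root_poly_perm s t : root_poly s %= root_poly t -> perm_eq s t.
Proof.
by rewrite eqp_monic ?monic_prod_XsubC // => /eqP; apply: prod_XsubC_eq.
Qed.

Lemma roots_of_dvd p s : p %| root_poly s -> exists t, roots_of p t.
Proof.
move=> p_s; have [m] := dvdp_prod_XsubC p_s.
set t := mask m s => /eqp_eq E; exists t.
have p0 : p != 0.
  apply: contraTneq p_s => ->; rewrite dvd0p monic_neq0 //; apply: monic_prod_XsubC.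
split=> //; move: E.
by rewrite (lead_coef_prod_XsubC t xpredT id) scale1r.
Qed.

Lemma size_roots_of p s : roots_of p s -> size p = (size s).+1.
Proof.
case=> p0 ->; rewrite size_scale ?lead_coef_eq0 //.
exact: size_prod_XsubC.
Qed.

Lemma roots_of_tuple p s n : roots_of p s -> size p = n.+1 ->
  exists t : n.-tuple R, roots_of p t.
Proof.
move=> ps; rewrite (size_roots_of ps) => -[sz].
by exists (tcast sz (in_tuple s)); rewrite val_tcast.
Qed.

Lemma roots_of_eqp p s : roots_of p s -> p %= root_poly s.
Proof. by case=> p0 {1}->; rewrite eqp_scale ?lead_coef_eq0. Qed.

Lemma eqp_mul p1 p2 q1 q2 : p1 %= q1 -> p2 %= q2 -> p1 * p2 %= q1 * q2.
Proof. by move=> E1 E2; apply: eqp_trans (eqp_mulr _ E1) (eqp_mull _ E2). Qed.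

Lemma eqp_prod (I : Type) (r : seq I) (P : pred I) (F1 F2 : I -> {poly R}) :
  (forall i, P i -> F1 i %= F2 i) ->
  \prod_(i <- r | P i) F1 i %= \prod_(i <- r | P i) F2 i.
Proof.
move=> F12; apply: (big_ind2 (fun p q => p %= q)); first exact: eqpxx.
  by move=> p1 p2 q1 q2; apply: eqp_mul.
exact: F12.
Qed.

Lemma quadratic_roots_exist (a b c : R) : a != 0 -> 0 <= b ^+ 2 - 4 * a * c ->
  exists s : 2.-tuple R, roots_of (a *: 'X^2 - b *: 'X + c%:P) s.
Proof.
move=> a0 disc; pose d := Num.sqrt (b ^+ 2 - 4 * a * c).
have dd : d ^+ 2 = b ^+ 2 - 4 * a * c by rewrite sqr_sqrtr.
pose s := [tuple (b + d) / (2 * a); (b - d) / (2 * a)].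
have E : a *: 'X^2 - b *: 'X + c%:P = a *: root_poly s.
  rewrite /root_poly !big_cons big_nil mulr1.
  have two0 : 2 * a != 0 by rewrite mulf_neq0 // pnatr_eq0.
  have sumE : b = a * ((b + d) / (2 * a) + (b - d) / (2 * a)) by field.
  have prodE : c = a * ((b + d) / (2 * a) * ((b - d) / (2 * a))).
    transitivity ((b ^+ 2 - d ^+ 2) / (4 * a)); last by field.
    by rewrite dd; field.
  rewrite {1}sumE {1}prodE -!mul_polyC !rmorphM !rmorphD /=.
  ring.
exists s; rewrite E; split.
  by rewrite scaler_eq0 negb_or a0 monic_neq0 // monic_prod_XsubC.
by rewrite lead_coefZ lead_coef_prod_XsubC mulr1.
Qed.
End Splitting.

Section CoronaPoly.
Variable R : rcfType.
Implicit Types (n r m : nat) (t x : R).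

Lemma corona_quadratic_roots n2 n3 r3 :
  exists s : 2.-tuple R, roots_of (corona_quadratic R n2 n3 r3) s.
Proof.
apply: quadratic_roots_exist; first by rewrite pnatr_eq0 addn2.
(* a sum of nonnegative terms, since the constant term is [N - n3] and the
   leading one [N * (1 + r3)], where [N = 2 * n2 + n3 + 2] *)
rewrite (_ : _ - _ = ((2 * n2 + n3 + 2) ^ 2 * r3 ^ 2
    + 4 * (2 * n2 + n3 + 2) * n3 * (1 + r3))%:R) ?ler0n //.
ring.
Qed.

(** Only the degree of the quartic matters later, hence only its leading
coefficient is recorded. *)
Lemma quartic_coefs n2 n3 r1 r2 r3 t : exists c0 c1 c2 c3 : R,
  corona_quartic n2 n3 r1 r2 r3 t =
  Poly [:: c0; c1; c2; c3; ((2 * n2 + n3 + 2) * (1 + r3) * (r1 + r2))%:R].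
Proof.
pose N : R := (2 * n2 + n3 + 2)%:R; pose e : R := (1 + r3)%:R.
pose f : R := (r1 + r2)%:R; pose g : R := r1%:R; pose k : R := n3%:R.
pose h : R := (r1 + r2 + n2 * r1)%:R; pose l : R := (r1 + r1 * n2)%:R.
exists (N * g - k * g - (2 - t) * l).
exists (- N * (e * g + f + 2 * g) + k * (f + g) + (2 - t) * (h + l * e)).
exists (N * (e * f + 2 * (e * g + f) + g) - k * f - (2 - t) * h * e).
exists (- N * (2 * e * f + e * g + f)).
apply: (@eq_poly_horner _ 1); first exact: oner_neq0.
move=> x _; rewrite horner_Poly /= !natrM -/N -/e -/f /corona_quartic.
rewrite -/N -/e -/f -/g -/h -/l -/k.
rewrite -polyC1 !(hornerD, hornerN, hornerZ, hornerM, horner_exp, hornerX, hornerC).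
ring.
Qed.

Lemma size_quartic n2 n3 r1 r2 r3 t : (0 < r1)%N ->
  size (corona_quartic n2 n3 r1 r2 r3 t) = 5%N.
Proof.
move=> r1_gt0; have [c0 [c1 [c2 [c3 ->]]]] := quartic_coefs n2 n3 r1 r2 r3 t.
rewrite (@PolyK _ 0) //=.
by rewrite pnatr_eq0 !muln_eq0 !addn_eq0 !(gtn_eqF r1_gt0) /= andbF.
Qed.

Lemma horner_quadratic n2 n3 r3 x :
  (corona_quadratic R n2 n3 r3).[x] =
  (x - 1) * (2 + 2 * n2 + n3)%:R * ((x - 1) * (r3 + 1)%:R + r3%:R) - n3%:R.
Proof.
rewrite /corona_quadratic !(hornerD, hornerN, hornerZ, hornerXn, hornerX).
by rewrite hornerC; ring.
Qed.

(** The shape in which the quartic comes out of the determinant: [F] and [E]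
are the denominators that the factor belonging to [t] is cleared of. *)
Lemma horner_quartic n2 n3 r1 r2 r3 t x (y := x - 1)
    (F := y * (r1 + r2)%:R + r2%:R) (E := y * (r3 + 1)%:R + r3%:R) :
  (corona_quartic n2 n3 r1 r2 r3 t).[x] =
  y * F * (corona_quadratic R n2 n3 r3).[x]
  - (2 - t) * E * (r1%:R * n2%:R * y + F).
Proof.
rewrite horner_quadratic /corona_quartic /F /E /y -polyC1.
rewrite !(hornerD, hornerN, hornerZ, hornerM, horner_exp, hornerX, hornerC).
ring.
Qed.

(** Up to a scalar, the linear polynomial whose root is the eigenvalue that the
eigenvalue [t] of a copy gives rise to. *)
Definition linear_factor (a b t : R) : {poly R} := (a + b) *: 'X - (a + b * t)%:P.
End CoronaPoly.

Section CoronaSpectrum.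
Variables (R : rcfType) (G1 G2 G3 : sgraph) (r1 r2 r3 : nat).
Hypotheses (reg1 : regular r1 G1) (reg2 : regular r2 G2) (reg3 : regular r3 G3).
Hypothesis r1_gt0 : (0 < r1)%N.
Local Notation C := (corona G1 G2 G3).
Local Notation n1 := #|G1|.
Local Notation m1 := #|edge_type G1|.
Local Notation Q := (corona_quadratic R #|G2| #|G3| r3).
Local Notation K := (corona_quartic #|G2| #|G3| r1 r2 r3).

Lemma degree_corona_neq0 (p : C) : degree p != 0%N.
Proof.
case: p => [[[v|e]|[v u]]|[e w]].
- by rewrite (degree_corona_vertex _ _ reg1) -lt0n.
- by rewrite degree_corona_edge.
- by rewrite (degree_corona_copy2 _ reg1 reg2) addn_eq0 negb_and -lt0n r1_gt0.
- by rewrite (degree_corona_copy3 _ reg3) addn1.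
Qed.

(** [fin_det_corona] is valid off the zeros of [y], [E] and [F].  Clearing
denominators consumes the factor of each copy at the eigenvalue 0, which is why
the spectra are given with one 0 split off. *)
Lemma corona_char_poly theta mu eta :
  is_spectrum (normalized_laplacian R G1) theta ->
  is_spectrum (normalized_laplacian R G2) (rcons mu 0) ->
  is_spectrum (normalized_laplacian R G3) (rcons eta 0) ->
  (\prod_(p : C) (degree p)%:R) *:
    (char_poly (normalized_laplacian R C) * Q ^+ n1) =
  r1%:R ^+ n1 *:
    ((\prod_(t <- mu) linear_factor r1%:R r2%:R t) ^+ n1 *
     (\prod_(t <- eta) linear_factor 1 r3%:R t) ^+ m1 *
     Q ^+ m1 * \prod_(t <- theta) K t).
Proof.
move=> G1_s G2_s G3_s; have r1_neq0 : r1%:R != 0 :> R by rewrite pnatr_eq0 -lt0n.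
have lin_neq0 (a b : R) : a + b != 0 -> linear_factor a b 0 != 0.
  move=> ab; rewrite /linear_factor -size_poly_gt0 size_polyDl.
    by rewrite size_scale // size_polyX.
  rewrite size_polyN size_scale // size_polyX.
  by rewrite ltnS size_polyC_leq1.
apply: (@eq_poly_horner _ (('X - 1%:P) * linear_factor r1%:R r2%:R 0 *
                          linear_factor 1 r3%:R 0)).
  rewrite !mulf_neq0 ?polyXsubC_eq0 ?lin_neq0 //.
    by rewrite -natrD pnatr_eq0 addn_eq0 negb_and -lt0n r1_gt0.
  by rewrite -(natrD _ 1) pnatr_eq0.
move=> x; rewrite !hornerM hornerXsubC !mulf_eq0 !negb_or => /andP[/andP[y0]].
pose y := x - 1; pose F : R := y * (r1 + r2)%:R + r2%:R.
pose E : R := y * (r3 + 1)%:R + r3%:R; rewrite -/y in y0.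
have lin_horner (a b t : R) : (linear_factor a b t).[x] = y * (a + b) + b * (1 - t).
  rewrite /linear_factor !(hornerD, hornerN, hornerZ, hornerX, hornerC) /y.
  by ring.
rewrite !lin_horner subr0 !mulr1 -natrD -/F [1 + _]addrC -(natrD _ _ 1) -/E.
move=> F0 E0.
have yr0 : y * r1%:R != 0 by rewrite mulf_neq0.
have := fin_det_corona reg1 reg2 reg3 G1_s G2_s G3_s yr0 F0 E0.
rewrite -char_poly_laplacian; last by move=> p; apply: degree_corona_neq0.
rewrite -/F -/E; set a := y * _ - _ / _.
have QE : Q.[x] = a * E by rewrite horner_quadratic -/y -/E [RHS]mulrBl divfK.
have KE t : (K t).[x] =
    E * F * y * r1%:R * (a - (#|G2|%:R / F + (y * r1%:R)^-1) * r1%:R * (2 - t)) / r1%:R.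
  rewrite horner_quartic -/y -/F -/E QE; clearbody a F E; field.
  by rewrite F0 y0 r1_neq0.
have prod2E : (\prod_(t <- mu) linear_factor r1%:R r2%:R t).[x] =
    \prod_(t <- mu) (y * (r1 + r2)%:R + r2%:R * (1 - t)).
  by rewrite horner_prod; apply: eq_bigr => t _; rewrite lin_horner -natrD.
have prod3E : (\prod_(t <- eta) linear_factor 1 r3%:R t).[x] =
    \prod_(t <- eta) (y * (r3 + 1)%:R + r3%:R * (1 - t)).
  rewrite horner_prod; apply: eq_bigr => t _.
  by rewrite lin_horner [1 + r3%:R]addrC -(natrD _ _ 1).
rewrite !hornerZ !hornerM !horner_exp QE prod2E prod3E horner_prod.
rewrite [\prod_(t <- theta) (K t).[x]](eq_bigr _ (fun t _ => KE t)).
rewrite !big_split /= !big_const_seq !count_predT (size_spectrum G1_s) !iter_mulr_1.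
rewrite !big_rcons /= subr0 !mulr1 -/F -/E !exprMn exprVn.
have rn0 : r1%:R ^+ n1 != 0 :> R by rewrite expf_neq0.
move: (r1%:R ^+ n1) (y ^+ n1) (a ^+ n1) (a ^+ m1) (E ^+ n1) (E ^+ m1) (F ^+ n1) rn0.
move: (_ ^+ n1) (_ ^+ m1) (\prod_(t <- theta) _) (\prod_(p : C) _) (_.[x]).
move=> A B T d p rn yn an am En Em Fn rn0 detE.
(* the determinant formula was divided by [E ^+ n1] through [a] *)
transitivity (En * (an * (d * p))); first by ring.
by rewrite detE; field.
Qed.
End CoronaSpectrum.

(** * Matching the roots *)

Lemma linear_factor_eqp (R : rcfType) (a b t : R) : a + b != 0 ->
  linear_factor a b t %= 'X - ((a + b * t) / (a + b))%:P.
Proof.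
move=> ab; rewrite -(eqp_rtrans (eqp_scale _ ab)) scalerBr.
by rewrite -[(a + b) *: _%:P]mul_polyC -polyCM mulrCA divff // mulr1 eqpxx.
Qed.

Lemma linear_factors_eqp (R : rcfType) (a b : R) n k (s : k.-tuple R) : a + b != 0 ->
  (\prod_(t <- take k.-1 s) linear_factor a b t) ^+ n %=
  root_poly (\big[cat/[::]]_(j < k.-1) nseq n ((a + b * s`_j) / (a + b))).
Proof.
move=> ab; rewrite root_poly_bigcat -prodrXl (big_nth 0) big_mkord.
have -> : size (take k.-1 s) = k.-1 by rewrite size_takel // size_tuple leq_pred.
apply: eqp_prod => j _; rewrite root_poly_nseq nth_take //.
exact/eqp_exp/linear_factor_eqp.
Qed.

Lemma rcons_take_last (R : rcfType) n (s : n.-tuple R) :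
  (0 < n)%N -> s`_n.-1 = 0 -> tval s = rcons (take n.-1 s) 0.
Proof.
move=> n_gt0 <-; rewrite -take_nth ?size_tuple ?prednK // take_oversize //.
by rewrite size_tuple.
Qed.

Lemma count_flatten_nseq (T : Type) (P : pred T) n (s : seq T) :
  count P (flatten (nseq n s)) = (n * count P s)%N.
Proof. by elim: n => //= n IHn; rewrite count_cat IHn mulSn. Qed.

Theorem corollary3p3 (R : rcfType) (G1 G2 G3 : sgraph)
    (n1 n2 n3 m1 r1 r2 r3 : nat)
    (hn1 : #|G1| = n1) (hn2 : #|G2| = n2) (hn3 : #|G3| = n3)
    (hm1 : #|edges G1| = m1)
    (n1_ge1 : (1 <= n1)%N) (n2_ge1 : (1 <= n2)%N) (n3_ge1 : (1 <= n3)%N)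
    (reg1 : regular r1 G1) (reg2 : regular r2 G2) (reg3 : regular r3 G3)
    (r1_ge1 : (1 <= r1)%N)
    (theta : n1.-tuple R) (mu : n2.-tuple R) (eta : n3.-tuple R)
    (theta_spec : is_spectrum (normalized_laplacian R G1) theta)
    (mu_spec : is_spectrum (normalized_laplacian R G2) mu)
    (eta_spec : is_spectrum (normalized_laplacian R G3) eta)
    (theta_sorted : sorted >=%R theta)
    (mu_sorted : sorted >=%R mu)
    (eta_sorted : sorted >=%R eta) :
  exists (c : 2.-tuple R) (d : 'I_n1 -> 4.-tuple R) (s : seq R),
    [/\ roots_of (corona_quadratic R n2 n3 r3) c,
        forall i : 'I_n1,
          roots_of (corona_quartic n2 n3 r1 r2 r3 (tnth theta i)) (d i),
        is_spectrum (normalized_laplacian R (corona G1 G2 G3)) s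
      & perm_eq
          (s ++ flatten (nseq (n1 - m1) (tval c)))
          (\big[cat/[::]]_(j < n2.-1)
              nseq n1 ((r1%:R + r2%:R * mu`_j) / (r1 + r2)%:R)
           ++ \big[cat/[::]]_(k < n3.-1)
                nseq m1 ((1 + r3%:R * eta`_k) / (r3 + 1)%:R)
           ++ flatten (nseq (m1 - n1) (tval c))
           ++ \big[cat/[::]]_(i < n1) tval (d i))].
Proof.
have m1E : #|edge_type G1| = m1 by rewrite card_sig -hm1; apply: eq_card.
clear hm1; subst n1 n2 n3.
have [c c_roots] := corona_quadratic_roots R #|G2| #|G3| r3.
have [s s_spec] := laplacian_spectrum R (corona G1 G2 G3).
have muE : tval mu = rcons (take #|G2|.-1 mu) 0.
  exact/rcons_take_last/(regular_last_eigenvalue reg2 mu_spec).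
have etaE : tval eta = rcons (take #|G3|.-1 eta) 0.
  exact/rcons_take_last/(regular_last_eigenvalue reg3 eta_spec).
have muS := mu_spec; rewrite muE in muS.
have etaS := eta_spec; rewrite etaE in etaS.
have {muS etaS} := corona_char_poly reg1 reg2 reg3 r1_ge1 theta_spec muS etaS.
set mu' := take _ mu; set eta' := take _ eta => charE.
set lhs := s ++ flatten (nseq #|G1| (tval c)).
have deg_neq0 : \prod_(p : corona G1 G2 G3) (degree p)%:R != 0 :> R.
  apply/prodf_neq0 => p _; rewrite pnatr_eq0.
  exact: degree_corona_neq0 reg1 reg2 reg3 r1_ge1 p.
have r1n_neq0 : r1%:R ^+ #|G1| != 0 :> R by rewrite expf_neq0 // pnatr_eq0 -lt0n.
have lhsE : root_poly lhs %=
    (\prod_(t <- mu') linear_factor r1%:R r2%:R t) ^+ #|G1| *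
    (\prod_(t <- eta') linear_factor 1 r3%:R t) ^+ m1 *
    corona_quadratic R #|G2| #|G3| r3 ^+ m1 *
    \prod_(i < #|G1|) corona_quartic #|G2| #|G3| r1 r2 r3 (tnth theta i).
  rewrite -(eqp_rtrans (eqp_scale _ r1n_neq0)) -m1E.
  rewrite -(big_tuple _ _ theta xpredT (corona_quartic #|G2| #|G3| r1 r2 r3)) -charE.
  rewrite (eqp_rtrans (eqp_scale _ deg_neq0)) root_poly_cat root_poly_flatten.
  rewrite eqp_sym; apply: eqp_mul; first exact: roots_of_eqp.
  exact/eqp_exp/roots_of_eqp.
have quartic_roots i : exists d : 4.-tuple R,
    roots_of (corona_quartic #|G2| #|G3| r1 r2 r3 (tnth theta i)) d.
  have [|t t_roots] := @roots_of_dvd _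
    (corona_quartic #|G2| #|G3| r1 r2 r3 (tnth theta i)) lhs.
    rewrite (eqp_dvdr _ lhsE) (bigD1 i) //= mulrA; apply: dvdp_mulr.
    by apply: dvdp_mull.
  exact: roots_of_tuple t_roots (size_quartic _ _ _ _ _ _).
have [d d_roots] := fin_all_exists quartic_roots.
exists c, d, s; split=> //.
set A := \big[cat/[::]]_(j < _) _; set B := \big[cat/[::]]_(k < _) _.
set D := \big[cat/[::]]_(i < _) _.
(* the form without subtraction: [n1] copies of [c] on the left, [m1] on the
   right *)
have : perm_eq lhs (A ++ B ++ flatten (nseq m1 (tval c)) ++ D).
  apply: root_poly_perm; rewrite (eqp_ltrans lhsE) !root_poly_cat !mulrA.
  rewrite root_poly_flatten /D root_poly_bigcat.
  apply: eqp_mul; last by apply: eqp_prod => i _; apply: roots_of_eqp.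
  apply: eqp_mul; last exact/eqp_exp/roots_of_eqp.
  apply: eqp_mul.
    rewrite /A natrD; apply: linear_factors_eqp.
    by rewrite -natrD pnatr_eq0 addn_eq0 negb_and -lt0n r1_ge1.
  rewrite /B addnC natrD; apply: linear_factors_eqp.
  by rewrite -(natrD _ 1) pnatr_eq0.
move/seq.permP => countE; apply/seq.permP => P; move: (countE P).
rewrite !count_cat !count_flatten_nseq.
(* cancel the [minn n1 m1] copies of [c] common to both sides *)
case: (leqP m1 #|G1|) => [/subnKC <-|/ltnW /subnKC <-];
  rewrite ?addKn ?subnDA ?subnn ?sub0n; lia.
Qed.
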